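(* Let $q$ be a prime power and let $n,k,d$ be integers with $3\le d\le 4$ and $n\le \frac{q^{n-k}-1}{q-1}-2$. Suppose there exists a linear $[n,k,d]_q2$ code that is quasi-perfect. Then there exists a linear $[n+1,k+1,3]_q2$ code that is quasi-perfect.
   Context: A linear $[n,k,d]_qR$ code is a $k$-dimensional subspace $C$ of $GF(q)^n$ with minimum Hamming distance $d=\min_{c_1\neq c_2\in C} d(c_1,c_2)$ and covering radius $R=\max_{x\in GF(q)^n}\min_{c\in C} d(x,c)$, where $d(\cdot,\cdot)$ is the Hamming distance. The packing radius of $C$ is $e(C)=\lfloor (d-1)/2\rfloor$. A code is called quasi-perfect if, for some nonnegative integer $e$, its packing radius is $e$ and its covering radius is $e+1$. *)

(* Defs.v *)
From mathcomp Require Export all_boot all_order all_algebra all_field.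

Set Implicit Arguments.
Unset Strict Implicit.
Unset Printing Implicit Defensive.

Definition prime_power (q : nat) : Prop :=
  exists p m : nat, [/\ prime p, 0 < m & q = p ^ m].

Section Codes.
Variables (F : finFieldType) (n : nat).
Implicit Types (x y : 'rV[F]_n) (C : {vspace 'rV[F]_n}).

Definition hamming_dist x y : nat := #|[set i | x ord0 i != y ord0 i]|.

(* A relation rather than a function: the zero code, which has no two distinct
   codewords, has no minimum distance. *)
Definition has_min_dist C (d : nat) : Prop :=
  (exists c1 c2, [/\ c1 \in C, c2 \in C, c1 != c2 & hamming_dist c1 c2 = d]) /\
  (forall c1 c2, c1 \in C -> c2 \in C -> c1 != c2 -> d <= hamming_dist c1 c2).

Definition dist_to_code x C : nat :=
  hamming_dist x [arg min_(c < (0%R : 'rV[F]_n) | c \in C) hamming_dist x c].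

Definition covering_radius C : nat := \max_(x : 'rV[F]_n) dist_to_code x C.

Definition has_packing_radius C (e : nat) : Prop :=
  exists2 d, has_min_dist C d & e = (d - 1) %/ 2.

Definition quasi_perfect C : Prop :=
  exists e : nat, has_packing_radius C e /\ covering_radius C = e + 1.

(* C is an [n,k,d]_q R code, where q = #|F|. *)
Definition linear_code C (k d R : nat) : Prop :=
  [/\ \dim C = k, has_min_dist C d & covering_radius C = R].

End Codes.

(* Main.v *)
Require Import Defs.
From mathcomp Require Import all_boot all_order all_algebra all_field.

(** Let [x] be a word at distance exactly [2] from [C] and take the code
    [C' = {(c + a x, a) | c \in C, a \in F}]; on the side of parity checks this
    appends the syndrome of [x] as a new column.  A codeword with [a != 0] has
    weight [1 + d(a x, - c) >= 3], and equality occurs since some [c] is at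
    distance [2] from [x].  A word [(y, b)] is at distance at most
    [d(y - b x, C) <= 2] from [C'].  Finally the balls of radius [1] around [C']
    contain at most [q^(k+1) (1 + (n+1)(q-1)) < q^(n+1)] words, so the covering
    radius of [C'] is not smaller than [2]. *)

Set Implicit Arguments.
Unset Strict Implicit.
Unset Printing Implicit Defensive.

Import GRing.Theory.
Local Open Scope ring_scope.

Section HammingDistance.
Variables (F : finFieldType) (n : nat).
Implicit Types (u v w : 'rV[F]_n) (C : {vspace 'rV[F]_n}).

Lemma hamming_dist_addr w u v : hamming_dist (u + w) (v + w) = hamming_dist u v.
Proof.
by apply: eq_card => i; rewrite !inE !mxE (inj_eq (addIr _)).
Qed.

Lemma hamming_dist_scale (s : F) u v :
  s != 0 -> hamming_dist (s *: u) (s *: v) = hamming_dist u v.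
Proof.
by move=> s0; apply: eq_card => i; rewrite !inE !mxE (inj_eq (mulfI s0)).
Qed.

Lemma hamming_dist_row_mx u v (a b : 'rV[F]_1) :
  hamming_dist (row_mx u a) (row_mx v b) = (hamming_dist u v + (a != b))%N.
Proof.
have eqab : (a == b) = (a 0 0 == b 0 0).
  apply/eqP/eqP => [-> // | ab].
  by apply/matrixP => i j; rewrite !ord1.
rewrite /hamming_dist -!sum1dep_card big_split_ord /=; congr (_ + _)%N.
  by apply: eq_bigl => i; rewrite !row_mxEl.
rewrite big_mkcond big_ord_recl big_ord0 /= !row_mxEr eqab addn0.
by case: eqP.
Qed.

Lemma dist_to_code_le C u c : c \in C -> (dist_to_code u C <= hamming_dist u c)%N.
Proof.
rewrite /dist_to_code; case: arg_minnP => [|m _ min_m]; first exact: mem0v.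
exact: min_m.
Qed.

Lemma dist_to_code_attained C u :
  exists2 c, c \in C & hamming_dist u c = dist_to_code u C.
Proof.
rewrite /dist_to_code; case: arg_minnP => [|m mC _]; first exact: mem0v.
by exists m.
Qed.

Lemma dist_to_code_le_covering_radius C u :
  (dist_to_code u C <= covering_radius C)%N.
Proof. exact: (leq_bigmax (F := fun x => dist_to_code x C)). Qed.

Lemma covering_radius_attained C : exists u, dist_to_code u C = covering_radius C.
Proof.
have := @eq_bigmax 'rV[F]_n (fun x => dist_to_code x C).
case; first by apply/card_gt0P; exists 0.
by move=> u eq_u; exists u.
Qed.

(** The set of differing coordinates has at most one element [i], and the error value is
    [a = u 0 i - v 0 i]. *)
Lemma hamming_dist_le1 u v :
  (hamming_dist u v <= 1)%N ->
  u = v \/ exists i, exists2 a, a != 0 & u = v + a *: delta_mx 0 i.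
Proof.
rewrite /hamming_dist; set D := finset _ => leD.
have [->|neq_uv] := eqVneq u v; first by left.
right; have [i iD] : exists i, i \in D.
  apply/set0Pn; apply: contra neq_uv => /eqP D0; apply/eqP/rowP => i.
  by have := in_set0 i; rewrite -D0 inE => /negbFE /eqP.
exists i, (u 0 i - v 0 i); first by rewrite subr_eq0; move: iD; rewrite inE.
apply/rowP => j; rewrite !mxE eqxx /=.
have [->|neq_ji] := eqVneq j i; first by rewrite mulr1 addrC subrK.
rewrite mulr0 addr0; apply/eqP; apply: contraNT neq_ji => neq_uvj.
by apply/eqP; apply: (card_le1_eqP leD) => //; rewrite inE.
Qed.

(** Sphere-covering bound: the balls of radius 1 around the codewords cover the space, and each has
    [1 + n * (#|F| - 1)] points. *)
Lemma covering_radius_le1_bound C :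
  (covering_radius C <= 1)%N ->
  (#|F| ^ n <= #|F| ^ \dim C * (1 + n * (#|F| - 1)))%N.
Proof.
move=> radC.
(* [T] indexes the errors of weight at most 1: [None] is the zero error, [Some (i, a)] puts [a != 0]
   at position [i]. *)
pose T := option ('I_n * {a : F | a != 0})%type.
pose err (t : T) : 'rV[F]_n :=
  if t is Some (i, a) then val a *: delta_mx 0 i else 0.
pose f (p : 'rV[F]_n * T) := p.1 + err p.2.
have cardT : #|{: T}| = (1 + n * (#|F| - 1))%N.
  rewrite card_option card_prod card_ord card_sig add1n.
  by congr (n * _).+1; rewrite subn1 -(cardC1 (0 : F)); apply: eq_card.
have cardV : #|{: 'rV[F]_n}| = (#|F| ^ n)%N by rewrite card_mx mul1n.
rewrite -cardV -card_vspace -cardT -cardsT.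
have -> : (#|C| * #|{: T}|)%N = #|setX [set c in C] [set: T]|.
  by rewrite cardsX cardsT cardsE.
(* It remains to see that every word is a codeword plus an error, so that [f] is onto. *)
apply: leq_trans (leq_imset_card f _); apply/subset_leq_card/subsetP => u _.
have [c cC duc] := dist_to_code_attained C u.
have /hamming_dist_le1 : (hamming_dist u c <= 1)%N.
  by rewrite duc (leq_trans (dist_to_code_le_covering_radius C u)).
case=> [->|[i [a a0 ->]]]; apply/imsetP.
  by exists (c, None); rewrite ?inE ?cC // /f addr0.
by exists (c, Some (i, Sub a a0)); rewrite ?inE ?cC.
Qed.

End HammingDistance.

Section ExtendedCode.
Variables (F : finFieldType) (n : nat) (C : {vspace 'rV[F]_n}) (x : 'rV[F]_n).

(** Right multiplication by [row_mx 1%:M 0] pads a word with a final zero. Writing the code as a sum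
    of subspaces makes linearity automatic. *)
Definition extended_code : {vspace 'rV[F]_(n + 1)} :=
  (linfun (mulmxr (row_mx 1%:M 0)) @: C + <[row_mx x 1%:M]>)%VS.

Lemma extended_codeP (w : 'rV[F]_(n + 1)) :
  reflect (exists2 c, c \in C & exists a : F, w = row_mx (c + a *: x) a%:M)
          (w \in extended_code).
Proof.
apply: (iffP memv_addP) => [[u /memv_imgP[c cC ->] [v /vlineP[a ->] ->]]|].
  exists c => //; exists a.
  by rewrite lfunE /= mul_mx_row mulmx1 mulmx0 scale_row_mx add_row_mx add0r
             scalemx1.
case=> c cC [a ->]; exists (row_mx c 0).
  by apply/memv_imgP; exists c; rewrite // lfunE /= mul_mx_row mulmx1 mulmx0.
exists (a *: row_mx x 1%:M); first exact: memvZ (memv_line _).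
by rewrite scale_row_mx add_row_mx add0r scalemx1.
Qed.

(** The last coordinate vanishes on the padded copy of [C] and equals [a] on [a *: row_mx x 1%:M],
    so the sum is direct; padding is injective. *)
Lemma dim_extended_code : \dim extended_code = (\dim C + 1)%N.
Proof.
rewrite dimv_disjoint_sum; last first.
  apply/eqP; rewrite -subv0; apply/subvP => w.
  rewrite memv_cap memv0 => /andP[/memv_imgP[c _ ->] /vlineP[a]].
  rewrite lfunE /= mul_mx_row mulmx1 mulmx0 scale_row_mx scalemx1.
  case/eq_row_mx => -> /rowP/(_ 0).
  by rewrite !mxE eqxx mulr1n => <-; rewrite scale0r row_mx0.
rewrite dim_vline limg_dim_eq.
  suff -> : row_mx x (1%:M : 'rV[F]_1) != 0 by [].
  apply/eqP.
  rewrite -[0]row_mx0 => /eq_row_mx[_ /rowP/(_ 0)].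
  by rewrite !mxE eqxx => /eqP; rewrite oner_eq0.
apply/eqP; rewrite -subv0; apply/subvP => c.
rewrite memv_cap memv0 memv_ker => /andP[_ /eqP].
rewrite lfunE /= mul_mx_row mulmx1 mulmx0 -[0 in RHS]row_mx0.
by case/eq_row_mx => ->.
Qed.

(** Words with equal last coordinates are at least [d] apart, as in [C]. Otherwise the last
    coordinate contributes 1, and the rest at least the distance from [x] to [C]. *)
Lemma min_dist_extended_code (d : nat) :
  has_min_dist C d -> (dist_to_code x C < d)%N ->
  has_min_dist extended_code (dist_to_code x C).+1.
Proof.
move=> [_ minC] ltd; split.
  have [c cC dxc] := dist_to_code_attained C x.
  exists (row_mx x 1%:M), (row_mx c 0).
  have neq10 : (1%:M : 'rV[F]_1) != 0.
    by apply/eqP => /rowP/(_ 0); rewrite !mxE => /eqP; rewrite oner_eq0.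
  split.
  - by apply/extended_codeP; exists 0; rewrite ?mem0v //; exists 1; rewrite add0r scale1r.
  - by apply/extended_codeP; exists c => //; exists 0; rewrite scale0r addr0 raddf0.
  - by apply: contraNneq neq10 => /eq_row_mx[_ ->].
  - by rewrite hamming_dist_row_mx dxc neq10 addn1.
move=> _ _ /extended_codeP[u uC [a ->]] /extended_codeP[v vC [b ->]].
rewrite hamming_dist_row_mx; have [<-|neq_ab] := eqVneq a b => neq_uv.
  rewrite hamming_dist_addr; apply: leq_trans (leq_trans ltd _) (leq_addr _ _).
  by apply: minC => //; apply: contraNneq neq_uv => ->.
have -> : (a%:M : 'rV[F]_1) != b%:M.
  by apply: contraNneq neq_ab => /rowP/(_ 0); rewrite !mxE eqxx !mulr1n => ->.
rewrite addn1 ltnS.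
have ab0 : a - b != 0 by rewrite subr_eq0.
(* Subtracting [u + b *: x] from both words and dividing by [a - b] turns this into a distance from
   [x] itself to a codeword of [C]. *)
have -> : hamming_dist (u + a *: x) (v + b *: x)
        = hamming_dist x ((a - b)^-1 *: (v - u)).
  rewrite -(hamming_dist_scale x _ ab0) scalerA divff // scale1r.
  rewrite -(hamming_dist_addr (u + b *: x) ((a - b) *: x)).
  by congr hamming_dist; [rewrite scalerBl addrCA subrK | rewrite addrA subrK].
by apply: dist_to_code_le; rewrite memvZ // memvB.
Qed.

Lemma covering_radius_extended_code_le :
  (covering_radius extended_code <= covering_radius C)%N.
Proof.
apply/bigmax_leqP => w _.
rewrite -[w]hsubmxK; set y := lsubmx w; set b := rsubmx w.
have [c cC dyc] := dist_to_code_attained C (y - b 0 0 *: x).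
have cC' : row_mx (c + b 0 0 *: x) b \in extended_code.
  by apply/extended_codeP; exists c => //; exists (b 0 0); rewrite -mx11_scalar.
apply: leq_trans (dist_to_code_le _ cC') _.
(* The chosen codeword copies the last coordinate [b], so only the distance from [y - b 0 0 *: x] to
   [c] remains. *)
rewrite hamming_dist_row_mx eqxx addn0 -{1}(subrK (b 0 0 *: x) y).
by rewrite hamming_dist_addr dyc dist_to_code_le_covering_radius.
Qed.

End ExtendedCode.

Local Close Scope ring_scope.

Theorem theorem2 (q : nat) (hq : prime_power q)
    (F : finFieldType) (hF : #|F| = q) (n k d : nat)
    (hd : 3 <= d <= 4)
    (hn : n + 2 <= (q ^ (n - k) - 1) %/ (q - 1)) :
  (exists C : {vspace 'rV[F]_n}, linear_code C k d 2 /\ quasi_perfect C) ->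
  exists C' : {vspace 'rV[F]_(n + 1)},
    linear_code C' (k + 1) 3 2 /\ quasi_perfect C'.
Proof.
case=> C [[dimC minC radC] _].
have [x] := covering_radius_attained C; rewrite radC => dxC.
have minC' : has_min_dist (extended_code C x) 3.
  by rewrite -dxC; apply: min_dist_extended_code minC _; rewrite dxC; case/andP: hd.
have q_gt1 : 1 < q by rewrite -hF finNzRing_gt1.
have le_kn : k <= n by rewrite -dimC (leq_trans (dimvS (subvf C))) // dimvf /dim /= mul1n.
have radC' : covering_radius (extended_code C x) = 2.
  apply/eqP; rewrite eqn_leq -{1}radC covering_radius_extended_code_le /= ltnNge.
  (* Radius at most 1 would give, after cancelling [q ^ (k + 1)], the bound
     [q ^ (n - k) <= 1 + (n + 1) * (q - 1)]. *)
  apply/negP => /covering_radius_le1_bound.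
  rewrite dim_extended_code dimC hF.
  have -> : n + 1 = (k + 1) + (n - k) by rewrite addnAC subnKC.
  rewrite expnD leq_pmul2l ?expn_gt0 ?(ltnW q_gt1) // addnAC subnKC //.
  apply/negP; rewrite -ltnNge.
  have q1_gt0 : 0 < q - 1 by rewrite subn_gt0.
  (* Clearing the quotient gives [(n + 2) * (q - 1) <= q ^ (n - k) - 1]; having [n + 2] in place of
     [n + 1] makes the contradiction strict. *)
  move: hn; rewrite leq_divRL // => hn'.
  rewrite -ltn_subRL.
  by apply: leq_trans hn'; rewrite ltn_pmul2r // ltn_add2l.
exists (extended_code C x); split; first by split; rewrite ?dim_extended_code ?dimC.
by exists 1; split=> //; exists 3.
Qed.
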